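(* Let $d,k\in\mathbb{N}$. If $X$ is an $\omega^{2d+1}$-large finite set with $\min X > \max\{4,k\}$ and $C$ is a $k$-coloring of an $X$-quasistrong finite binary tree $T$ (i.e. $C:T\to\{0,\dots,k-1\}$), then there exist an $\omega^d$-large $Y\subseteq X$ and a tree $S\subseteq T$ such that $S$ is both $Y$-quasistrong and $(C,Y)$-prehomogeneous.
   Context: Strings are finite binary strings; $\sigma\preceq\tau$ means $\sigma$ is an initial segment of $\tau$, $|\sigma|$ is the length, $\sigma\upharpoonright n$ the initial segment of length $n$, and $2^i$ also denotes the set of strings of length $i$. A tree is a set of strings closed under initial segments. For a finite set $X=\{x_0<\dots<x_n\}\subseteq\mathbb{N}$, a finite binary tree $T$ is $X$-quasistrong if (i) $T\cap 2^{x_i}\neq\emptyset$ for every $i\le n$, and (ii) for each $i<n$, every $\sigma\in T\cap 2^{x_i}$ has exactly two incompatible extensions in $T\cap 2^{x_{i+1}}$. Given such $X$ and a coloring $C$, a tree $T$ is $(C,X)$-prehomogeneous if there is a color $c$ such that for every $i<n$, every $\sigma\in T\cap 2^{x_i}$ and every $\tau\in T\cap 2^{x_{i+1}}$ with $\sigma\prec\tau$, there is $\zeta\in T$ with $\sigma\preceq\zeta\preceq\tau$ and $C(\zeta)=c$. Largeness: for finite sets, $X<Y$ means $X=\emptyset\ne Y$ or $\max X<\min Y$; a stack is a sequence $X_0<X_1<\dots<X_{n-1}$ of nonempty finite sets. $X$ is $\omega^0$-large iff nonempty; $X$ is $\omega$-large if $|X|>\min X$; $X$ is $\omega^d\cdot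 n$-large if it is the union of a stack of $n$ many $\omega^d$-large sets; $X$ is $\omega^{d+1}$-large if $X=\{\min X\}\cup X_1$ with $\min X_1>\min X$ and $X_1$ $\omega^d\cdot\min X$-large. *)

(* Defs.v *)
(* Strings = seq bool; finite sets of naturals = strictly
   increasing seq nat; finite trees = seq (seq bool) (read as a set). *)
From mathcomp Require Import all_boot.
Set Implicit Arguments. Unset Strict Implicit. Unset Printing Implicit Defensive.

Definition is_tree (T : seq (seq bool)) : Prop :=
  forall s, s \in T -> forall n, take n s \in T.

(* stack_large P n X : X is the union of a stack X_0 < ... < X_{n-1} of
   nonempty sets each satisfying P (X given as a sorted list, so the stack
   is a splitting of X into consecutive nonempty blocks). *)
Fixpoint stack_large (P : seq nat -> Prop) (n : nat) (X : seq nat) : Prop :=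
  match n with
  | 0 => X = [::]
  | n'.+1 => exists X0 X1, [/\ X = X0 ++ X1, X0 != [::], P X0 & stack_large P n' X1]
  end.

Fixpoint large (d : nat) (X : seq nat) : Prop :=
  match d with
  | 0 => X != [::]
  | d'.+1 =>
      match X with
      | [::] => False
      | x :: X1 => stack_large (large d') x X1   (* min X = x, X1 = X \ {min X} *)
      end
  end.

Definition finset_nat (X : seq nat) : Prop := sorted ltn X.

Definition quasistrong (X : seq nat) (T : seq (seq bool)) : Prop :=
  (forall x, x \in X -> exists2 s, s \in T & size s = x) /\
  (forall i, i.+1 < size X ->
     forall s, s \in T -> size s = nth 0 X i ->
       exists t1 t2, t1 != t2 /\
         t1 \in T /\ t2 \in T /\ size t1 = nth 0 X i.+1 /\ size t2 = nth 0 X i.+1 /\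
         prefix s t1 /\ prefix s t2 /\
         (forall t, t \in T -> size t = nth 0 X i.+1 -> prefix s t ->
           t = t1 \/ t = t2)).

Definition prehomogeneous (k : nat) (C : seq bool -> nat) (X : seq nat)
    (T : seq (seq bool)) : Prop :=
  exists2 c, c < k &
    forall i, i.+1 < size X ->
      forall s t, s \in T -> size s = nth 0 X i ->
        t \in T -> size t = nth 0 X i.+1 -> prefix s t -> s != t ->
        exists2 z, z \in T & [/\ prefix s z, prefix z t & C z = c].

(* Main.v *)
Require Import Defs.
From mathcomp Require Import all_boot zify.

(** From a node [t], a colour [c] and a list of levels, look for a strong subtree
    above [t] whose nodes on those levels all have colour [c]; the upper
    endpoints of the gaps then witness prehomogeneity. By induction on [d], an
    [omega^(2d)*4]-large set [B] contains a single set [Y], essentially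
    [omega^d]-large, on which every node at level [min B] has such a subtree for
    a colour of its own. In the step, the last quarter of [B] yields a long
    sequence of blocks to which the induction hypothesis applies, and these are
    treated from the last one downwards. Given the last block, either for every
    root some colour remains visible at that block from all nodes reachable in
    the preceding segment, so that the block can be appended to any selection
    made in that segment, or some root can be moved up so as to lose a colour;
    the latter happens at most [k] times per root. The bound on the number of
    blocks so obtained is an iterated exponential of [min B] and does not depend
    on the branching between blocks. After a pigeonhole on the vectors of
    colours, the chosen blocks have constant colour for each root.
    Finally, [k] levels below [B] suffice to find a node both of whose
    successors see a common colour; its level becomes [min Y]. *)

Set Implicit Arguments. Unset Strict Implicit. Unset Printing Implicit Defensive.

(** * Prefixes, stacks and the growth of large sets *)

Lemma prefix_comparable (T : eqType) (a b t : seq T) :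
  prefix a t -> prefix b t -> size a <= size b -> prefix a b.
Proof.
rewrite !prefixE => /eqP ha /eqP hb hs.
by rewrite -hb take_takel // ha.
Qed.

Lemma prefix_size_eq (T : eqType) (a t : seq T) :
  prefix a t -> size a = size t -> a = t.
Proof. by rewrite prefixE => /eqP ha hs; rewrite -ha hs take_size. Qed.

Lemma finite_choice (A : eqType) (B : Type) (b0 : B) (P : A -> B -> Prop)
    (l : seq A) :
  (forall x, x \in l -> exists y, P x y) ->
  exists f, forall x, x \in l -> P x (f x).
Proof.
elim: l => [|a l IH] H; first by exists (fun=> b0).
have [|f hf] := IH; first by move=> x hx; apply: H; rewrite inE hx orbT.
have [|y hy] := H a; first by rewrite inE eqxx.
exists (fun x => if x == a then y else f x) => x; rewrite inE.
by case: eqVneq => [-> //|_] /= /hf.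
Qed.

Lemma stack_large_take (P : seq nat -> Prop) m n Y : m <= n ->
  stack_large P n Y ->
  exists Y1 Y2, Y = Y1 ++ Y2 /\ stack_large P m Y1.
Proof.
elim: m n Y => [|m IH] n Y; first by exists [::], Y.
case: n => // n hmn [Y0 [Y1 [-> n0 p0 h1]]].
have [Z1 [Z2 [-> hZ]]] := IH _ _ hmn h1.
exists (Y0 ++ Z1), Z2; split; first by rewrite catA.
by exists Y0, Z1.
Qed.

Lemma stack_large_size (P : seq nat -> Prop) n Y :
  stack_large P n Y -> n <= size Y.
Proof.
elim: n Y => // n IH Y [Y0 [Y1 [-> n0 _ /IH h1]]].
by case: Y0 n0 => // a Y0 _; rewrite size_cat /=; lia.
Qed.

Lemma path_ltn_last a Y : path ltn a Y -> a + size Y <= last a Y.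
Proof.
elim: Y a => [|b Y IH] a /=; first by rewrite addn0.
by case/andP=> hab /IH; lia.
Qed.

(** A block with minimum [y] contains a stack of [y] nonempty sets above [y], so its last element is
    at least [2 * y]: each block of the stack doubles the bound. *)
Lemma stack_large_last d n Y a :
  stack_large (large d.+1) n Y -> path ltn a Y -> a * 2 ^ n <= last a Y.
Proof.
elim: n Y a => [|n IH] Y a; first by move=> -> _ /=; lia.
case=> -[|y Y0] [Y1 [-> // _ h0 h1]].
rewrite cat_path last_cat /= => /andP[/andP[hay hp] hp1].
have := path_ltn_last hp; have := stack_large_size h0 => h2 h3.
apply: leq_trans (IH _ _ h1 hp1).
by rewrite expnS mulnA leq_mul2r; apply/orP; right; lia.
Qed.

Lemma large_last d x Y : large d.+2 (x :: Y) -> path ltn x Y ->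
  x * 2 ^ x <= last x Y.
Proof. exact: stack_large_last. Qed.

(** In the application [m] counts the nodes on level [z], and [z], [z2], [z3], [z4] are the minima
    of four consecutive large sets. Three exponential jumps absorb the bound: [k ^ m <= 2 ^ z2], the
    total exponent over base 2 is at most [z3], and [2 ^ z3 <= z4]. *)
Lemma block_count_bound m k z z2 z3 z4 : m <= 2 ^ z -> k <= z -> 4 < z ->
  z * 2 ^ z <= z2 -> z2 * 2 ^ z2 <= z3 -> z3 * 2 ^ z3 <= z4 ->
  (m * k).+2 ^ (z.+1 * k ^ m) <= z4.
Proof.
move=> hm hk hz h2 h3 h4; have hlt := ltn_expl z (ltnSn 1).
have z30 : 0 < z3 by have := expn_gt0 2 z2; have := expn_gt0 2 z; nia.
apply: leq_trans h4; apply: (leq_trans (n := 2 ^ z3)); last exact: leq_pmull.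
have hb : (m * k).+2 <= 2 ^ (2 * z).
  by rewrite mul2n -addnn expnD; have := leq_mul hm hk; nia.
have hc : k ^ m <= 2 ^ z2.
  apply: leq_trans (leq_pexp2l (isT : 0 < 2) h2); rewrite expnM.
  apply: (leq_trans (n := (2 ^ z) ^ m)); last by rewrite leq_pexp2l // expn_gt0.
  case: (posnP m) => [-> //|m0]; rewrite leq_exp2r //; lia.
case: (posnP (z.+1 * k ^ m)) => [-> |h0]; first by rewrite expn0 expn_gt0.
apply: (leq_trans (n := (2 ^ (2 * z)) ^ (z.+1 * k ^ m))); first by rewrite leq_exp2r.
rewrite -expnM leq_pexp2l //; apply: leq_trans h3; rewrite mulnA leq_mul //.
apply: leq_trans h2; rewrite -mulnA mulnCA leq_mul //.
(* What remains is [2 * z.+1 <= 2 ^ z]. *)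
have e : 2 ^ z = 2 ^ (z - 3) * 8 by rewrite -[8]/(2 ^ 3) -expnD subnK //; lia.
have := ltn_expl (z - 3) (ltnSn 1); lia.
Qed.

Lemma size_uniq_strings z (l : seq (seq bool)) :
  uniq l -> (forall s, s \in l -> size s = z) -> size l <= 2 ^ z.
Proof.
move=> ul hl; rewrite -card_bool -card_tuple cardE -(size_map val).
apply: uniq_leq_size => // s sl; apply/mapP.
by exists (Tuple (introT eqP (hl s sl))); rewrite ?mem_enum.
Qed.

(** * Concatenation of blocks into large sets *)

Lemma sorted_flatten (L : nat -> seq nat) J :
  sorted ltn J -> (forall j, j \in J -> sorted ltn (L j)) ->
  (forall j j' y y', j \in J -> j' \in J -> j < j' ->
     y \in L j -> y' \in L j' -> y < y') ->
  sorted ltn (flatten [seq L j | j <- J]).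
Proof.
elim: J => // j J IH; rewrite /= path_sortedE; last exact: ltn_trans.
case/andP=> /allP hj sJ hL hlt.
rewrite sorted_pairwise ?pairwise_cat; last exact: ltn_trans.
rewrite -!sorted_pairwise; try exact: ltn_trans.
rewrite hL ?inE ?eqxx // IH //=.
- rewrite andbT; apply/allrelP=> y y' hy /flattenP[? /mapP[j' hj' ->] hy'].
  apply: (hlt j j') => //; [exact: mem_head| |exact: hj].
  by rewrite inE hj' orbT.
- by move=> j' hj'; apply: hL; rewrite inE hj' orbT.
- by move=> j1 j2 y y' h1 h2; apply: hlt; rewrite inE ?h1 ?h2 orbT.
Qed.

(* [b] bounds the possible minima [u] to be put in front of [Y]; the spare
   last element [w] becomes the minimum of the next set of a stack. *)
Definition relarge (d b : nat) (Y : seq nat) : Prop :=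
  forall u, u <= b -> exists Z w, subseq (rcons Z w) Y /\ large d (u :: Z).

(** The first block completes [w] to a large set and leaves a spare element [w1]. As [w1] lies in
    that block, it is at most [e j'] for all later [j'], so it can play the role of [w] for the
    remaining blocks. *)
Lemma relarge_chain d (e : nat -> nat) (L : nat -> seq nat) J w n :
  (forall j, j \in J -> relarge d (e j) (L j)) ->
  (forall j j' y, j \in J -> j' \in J -> j < j' -> y \in L j -> y <= e j') ->
  sorted ltn J -> (forall j, j \in J -> w <= e j) -> n <= size J ->
  exists Z w', stack_large (large d) n Z /\
    subseq (rcons Z w') (w :: flatten [seq L j | j <- J]).
Proof.
elim: J w n => [|j J IH] w n hr ho hs hw.
  by rewrite leqn0 => /eqP ->; exists [::], w; rewrite /= eqxx.
case: n => [|n] /= hn.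
  by exists [::], w; rewrite /= eqxx sub0seq.
have jJ : j \in j :: J by rewrite inE eqxx.
have inJ j' : j' \in J -> j' \in j :: J by rewrite inE => ->; rewrite orbT.
have [Z1 [w1 [hZ1 lZ1]]] := hr j jJ w (hw j jJ).
have [|||||Z2 [w2 [sZ2 hZ2]]] := IH w1 n.
- by move=> j' /inJ; apply: hr.
- by move=> j1 j2 y /inJ h1 /inJ h2; apply: ho.
- exact: path_sorted hs.
- move=> j' hj'; apply: (ho j) => //; first exact: inJ.
    by move: hs; rewrite /= path_sortedE; [case/andP=> /allP/(_ _ hj')|exact: ltn_trans].
  by apply: (mem_subseq hZ1); rewrite mem_rcons inE eqxx.
- by [].
exists ((w :: Z1) ++ Z2), w2; split; first by exists (w :: Z1), Z2.
rewrite rcons_cat /= eqxx.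
apply: (subseq_trans (y := Z1 ++ w1 :: flatten [seq L j0 | j0 <- J])).
  exact: cat_subseq.
by rewrite -cat_rcons; apply: cat_subseq.
Qed.

(** * Gluing trees above two incompatible nodes *)

Section Gluing.

Variables (T : seq (seq bool)) (C : seq bool -> nat).

Definition comparable_to (t : seq bool) (S : seq (seq bool)) :=
  forall s, s \in S -> prefix s t || prefix t s.

(** Uniqueness of the node on the lowest level of [Z] ensures that gluing two such trees below a
    common node gives that node exactly two extensions. *)
Definition homogeneous_tree c t Z S :=
  [/\ is_tree S, {subset S <= T}, t \in S, comparable_to t S &
   [/\ quasistrong Z S, forall s, s \in S -> size s \in Z -> C s = c &
     0 < size Z -> exists r, [/\ r \in S, size r = head 0 Z &
       forall s, s \in S -> size s = head 0 Z -> s = r]]].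

Lemma comparable_prefix r t S : prefix r t -> comparable_to t S ->
  comparable_to r S.
Proof.
move=> rt hS s /hS /orP[st|ts]; last by rewrite (prefix_trans rt ts) orbT.
case: (leqP (size s) (size r)) => h.
  by rewrite (prefix_comparable st rt).
by rewrite (prefix_comparable rt st) ?orbT // ltnW.
Qed.

Lemma comparable_size_eq t S s : comparable_to t S -> s \in S ->
  size s = size t -> s = t.
Proof.
move=> hS /hS /orP[] h e; first exact: prefix_size_eq.
by apply/esym/prefix_size_eq.
Qed.

Lemma prefixes_tree (Ttree : is_tree T) r y : r \in T -> size r = y ->
  exists S, [/\ is_tree S, {subset S <= T}, r \in S, comparable_to r S &
    quasistrong [:: y] S].
Proof.
move=> rT ry; exists [seq take n r | n <- iota 0 (size r).+1].
have hmem s : s \in [seq take n r | n <- iota 0 (size r).+1] -> prefix s r.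
  by case/mapP=> n _ ->; apply: prefix_take.
have rS : r \in [seq take n r | n <- iota 0 (size r).+1].
  by apply/mapP; exists (size r); rewrite ?take_size // mem_iota add0n ltnS leqnn.
split=> //.
- move=> s /mapP[m hm ->] n; apply/mapP; exists (minn n m).
    by move: hm; rewrite !mem_iota; lia.
  by rewrite take_min.
- by move=> s /mapP[n _ ->]; apply: Ttree.
- by move=> s /hmem ->.
- split; last by case.
  by move=> x; rewrite inE => /eqP ->; exists r.
Qed.

(** From level [size t1] on, nodes of [S1] extend [t1] and nodes of [S2] extend [t2], so no node of
    one is comparable with a node of the other. Successors on levels of [Z] therefore stay within
    one tree, and the successors of [r] are the two unique lowest nodes. *)
Lemma join_trees c r t1 t2 y Z S1 S2 :
  prefix r t1 -> prefix r t2 -> t1 != t2 -> size t1 = size t2 ->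
  size r = y -> size r < size t1 -> size t1 <= head 0 Z -> 0 < size Z ->
  sorted ltn Z ->
  homogeneous_tree c t1 Z S1 -> homogeneous_tree c t2 Z S2 ->
  [/\ is_tree (S1 ++ S2), {subset S1 ++ S2 <= T}, r \in S1 ++ S2,
    comparable_to r (S1 ++ S2) & quasistrong (y :: Z) (S1 ++ S2)] /\
  (forall s, s \in S1 ++ S2 -> size s \in Z -> C s = c).
Proof.
move=> rt1 rt2 t12 ts ry rt tZ Z0 sZ [tr1 sb1 i1 cm1 [q1 c1 u1]]
  [tr2 sb2 i2 cm2 [q2 c2 u2]].
have cmr : comparable_to r (S1 ++ S2).
  by move=> s; rewrite mem_cat => /orP[]; [apply: (comparable_prefix rt1 cm1)|apply: (comparable_prefix rt2 cm2)].
have rS : r \in S1.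
  by move: rt1; rewrite prefixE => /eqP <-; apply: tr1.
have above1 s : s \in S1 -> size t1 <= size s -> prefix t1 s.
  move=> /cm1 /orP[] // h1 h2; have := size_prefix h1 => h3.
  by rewrite (prefix_size_eq h1) ?prefix_refl //; apply/eqP; rewrite eqn_leq h2 h3.
have above2 s : s \in S2 -> size t2 <= size s -> prefix t2 s.
  move=> /cm2 /orP[] // h1 h2; have := size_prefix h1 => h3.
  by rewrite (prefix_size_eq h1) ?prefix_refl //; apply/eqP; rewrite eqn_leq h2 h3.
have disj s s' : prefix t1 s -> prefix t2 s' -> prefix s s' || prefix s' s -> False.
  move=> h1 h2 h; have [u [g1 g2]] : exists u, prefix t1 u /\ prefix t2 u.
    case/orP: h => h; first by exists s'; split=> //; apply: prefix_trans h.
    by exists s; split=> //; apply: prefix_trans h.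
  have := prefix_comparable g1 g2; rewrite ts => /(_ (leqnn _)) g3.
  by case/eqP: t12; apply: prefix_size_eq.
have ltZ i : i < size Z -> size t1 <= nth 0 Z i.
  move=> hi; apply: leq_trans tZ _; rewrite -nth0.
  by apply: (sorted_leq_nth leq_trans leqnn) => //; apply: sub_sorted sZ => ? ?; apply: ltnW.
split; first split=> //.
- by move=> s; rewrite mem_cat => /orP[] h n; rewrite mem_cat ?(tr1 _ h) ?(tr2 _ h) ?orbT.
- by move=> s; rewrite mem_cat => /orP[]; [apply: sb1|apply: sb2].
- by rewrite mem_cat rS.
- split.
    move=> x; rewrite inE => /predU1P[->|/q1.1[s h1 h2]].
      by exists r; rewrite ?mem_cat ?rS.
    by exists s; rewrite ?mem_cat ?h1.
  case=> [|i] /=.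
    move=> _ s sS sy; have -> : s = r.
      by apply: (comparable_size_eq cmr) => //; rewrite sy.
    have [r1 [r1S r1s r1u]] := u1 Z0; have [r2 [r2S r2s r2u]] := u2 Z0.
    have p1 : prefix t1 r1 by apply: above1 => //; rewrite r1s.
    have p2 : prefix t2 r2 by apply: above2 => //; rewrite r2s -ts.
    exists r1, r2; split.
      by apply/eqP=> e; apply: (disj r1 r2) => //; rewrite e prefix_refl.
    rewrite !mem_cat r1S r2S orbT nth0; do ![split=> //].
    + exact: prefix_trans p1.
    + exact: prefix_trans p2.
    + move=> t; rewrite mem_cat => /orP[] tS tsz _.
        by left; apply: r1u.
      by right; apply: r2u.
  rewrite ltnS => hi s; rewrite mem_cat => /orP[] sS sz.
    have [a [b [h1 [h2 [h3 [h4 [h5 [h6 [h7 h8]]]]]]]]] := q1.2 i hi s sS sz.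
    exists a, b; rewrite !mem_cat h2 h3; do ![split=> //].
    move=> t; rewrite mem_cat => /orP[] tS tz st; first exact: h8.
    case: (disj s t); rewrite ?st //.
      by apply: above1 => //; rewrite sz ltZ // ltnW.
    by apply: above2 => //; rewrite tz -ts ltZ.
  have [a [b [h1 [h2 [h3 [h4 [h5 [h6 [h7 h8]]]]]]]]] := q2.2 i hi s sS sz.
  exists a, b; rewrite !mem_cat h2 h3 !orbT; do ![split=> //].
  move=> t; rewrite mem_cat => /orP[] tS tz st; last exact: h8.
  case: (disj t s); rewrite ?st ?orbT //.
    by apply: above1 => //; rewrite tz ltZ.
  by apply: above2 => //; rewrite sz -ts ltZ // ltnW.
- by move=> s; rewrite mem_cat => /orP[]; [apply: c1|apply: c2].
Qed.

End Gluing.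

(** * Levels, nodes and strong subtrees of a quasistrong tree *)

Section Tree.

Variables (k : nat) (X : seq nat) (T : seq (seq bool)) (C : seq bool -> nat).
Hypotheses (sX : sorted ltn X) (qT : quasistrong X T)
  (kC : forall s, s \in T -> C s < k).

(* [next] of the last element of [X] is the junk value [0]; no proper extension
   of a node has that length. *)
Definition next y := nth 0 X (index y X).+1.

Definition node (t : seq bool) := (t \in T) && (size t \in X).

Lemma index_lt y y' : y \in X -> y' \in X -> (index y X < index y' X) = (y < y').
Proof.
move=> hy hy'; apply/idP/idP; first exact: (sorted_ltn_index ltn_trans sX).
apply: contraTT; rewrite -!leqNgt.
by apply: (sorted_leq_index leq_trans leqnn) => //; apply: sub_sorted sX => ? ?; apply: ltnW.
Qed.

Lemma next_mem y y' : y \in X -> y' \in X -> y < y' -> next y \in X.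
Proof.
move=> hy hy'; rewrite -index_lt // => h; apply: mem_nth.
by apply: leq_ltn_trans h _; rewrite index_mem.
Qed.

Lemma next_gt y y' : y \in X -> y' \in X -> y < y' -> y < next y.
Proof.
move=> hy hy'; rewrite -index_lt // => h.
have hs : (index y X).+1 < size X by apply: leq_ltn_trans h _; rewrite index_mem.
rewrite -[X in X < _](nth_index 0 hy).
by apply: (sorted_ltn_nth ltn_trans 0 sX) => //; rewrite inE index_mem.
Qed.

Lemma next_le y y' : y \in X -> y' \in X -> y < y' -> next y <= y'.
Proof.
move=> hy hy' hyy'; have := next_mem hy hy' hyy'.
have := hyy'; rewrite -index_lt // => h nX.
rewrite leqNgt -index_lt // -leqNgt /next index_uniq //.
  by apply: leq_ltn_trans h _; rewrite index_mem.
exact: (sorted_uniq ltn_trans ltnn sX).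
Qed.

Lemma node_split r y : node r -> y \in X -> size r < y ->
  exists t1 t2, [/\ t1 != t2, node t1 /\ node t2,
    size t1 = next (size r) /\ size t2 = next (size r)
    & prefix r t1 /\ prefix r t2].
Proof.
case/andP=> rT rX yX ry; have nX := next_mem rX yX ry.
have hs : (index (size r) X).+1 < size X.
  by move: ry; rewrite -index_lt // => h; apply: leq_ltn_trans h _; rewrite index_mem.
have [|t1 [t2 [h1 [h2 [h3 [h4 [h5 [h6 [h7 _]]]]]]]]] := qT.2 _ hs r rT.
  by rewrite nth_index.
by exists t1, t2; rewrite /node h2 h3 h4 h5 -/(next _) nX.
Qed.

Lemma node_extend t y : node t -> y \in X -> size t <= y ->
  exists2 r, node r & size r = y /\ prefix t r.
Proof.
move=> nt yX; have [n] := ubnP (y - size t); elim: n t nt => // n IH t nt hn.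
rewrite leq_eqVlt => /predU1P[<-|ty]; first by exists t; rewrite ?prefix_refl.
have tX : size t \in X by case/andP: nt.
have [t1 [_ [_ [n1 _] [s1 _] [p1 _]]]] := node_split nt yX ty.
have h1 := next_gt tX yX ty; have h2 := next_le tX yX ty.
have [||r nr [hr pr]] := IH t1 n1; try by rewrite s1; lia.
by exists r => //; split=> //; apply: prefix_trans pr.
Qed.

(* The continuation [K] is required of all next-level successors of the nodes
   on the last level, so that subtrees can be stacked ([win_cat]). *)
Fixpoint win (c : nat) (Y : seq nat) (K : seq bool -> Prop) (t : seq bool) :=
  if Y is y :: Y' then
    exists r, [/\ r \in T, prefix t r, size r = y, C r = c &
      forall t', t' \in T -> size t' = next y -> prefix r t' -> win c Y' K t']
  else K t.

Lemma win_cat c Y1 Y2 K t : win c Y1 (win c Y2 K) t -> win c (Y1 ++ Y2) K t.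
Proof.
elim: Y1 t => //= y Y1 IH t [r [h1 h2 h3 h4 h5]].
by exists r; split=> // t' g1 g2 g3; apply/IH/h5.
Qed.

Notation top := (fun=> True).

Lemma win_down c Y t t' : prefix t t' -> win c Y top t' -> win c Y top t.
Proof.
case: Y => //= y Y htt' [r [h1 h2 h3 h4 h5]].
by exists r; split=> //; apply: prefix_trans h2.
Qed.

(** All of [Y] lies below the level [b] of [X], so the successors of the last nodes chosen still
    have level at most [b], where [K] is known. *)
Lemma win_top c Y K b t : b \in X -> {subset Y <= X} ->
  (forall y, y \in Y -> y < b) -> node t -> size t <= b ->
  (forall t', node t' -> prefix t t' -> size t' <= b -> K t') ->
  win c Y top t -> win c Y K t.
Proof.
move=> bX; elim: Y t => [|y Y IH] t YX Yb nt tb hK /=.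
  by move=> _; apply: hK => //; apply: prefix_refl.
have yX : y \in X by apply: YX; rewrite inE eqxx.
have yb : y < b by apply: Yb; rewrite inE eqxx.
move=> [r [h1 h2 h3 h4 h5]]; exists r; split=> // t' g1 g2 g3.
apply: IH; last exact: h5.
- by move=> z hz; apply: YX; rewrite inE hz orbT.
- by move=> z hz; apply: Yb; rewrite inE hz orbT.
- by rewrite /node g1 g2 (next_mem yX bX).
- by rewrite g2 next_le.
- move=> t'' n'' p''; apply: hK => //.
  exact: prefix_trans h2 (prefix_trans g3 p'').
Qed.

Lemma win_subseq c Y Z t : sorted ltn Y -> {subset Y <= X} -> subseq Z Y ->
  win c Y top t -> win c Z top t.
Proof.
elim: Y Z t => [|y Y IH] Z t sY YX; first by rewrite subseq0 => /eqP ->.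
case: Z => // z Z; rewrite [subseq _ _]/=.
have sY' : sorted ltn Y by apply: path_sorted sY.
have YX' : {subset Y <= X} by move=> x hx; apply: YX; rewrite inE hx orbT.
have yX : y \in X by apply: YX; rewrite inE eqxx.
case: eqP => [-> hZ [r [h1 h2 h3 h4 h5]]|_ hZ [r [h1 h2 h3 h4 h5]]].
  by exists r; split=> // t' g1 g2 g3; apply: IH => //; apply: h5.
have zY : z \in Y by apply: (mem_subseq hZ); rewrite inE eqxx.
have yz : y < z.
  by move: sY; rewrite /= path_sortedE; [case/andP=> /allP/(_ _ zY)|exact: ltn_trans].
have nr : node r by rewrite /node h1 h3.
(* A level that [Z] omits is passed by following a single successor of [r]. *)
have [|t1 [_ [_ [/andP[n1 _] _] [s1 _] [p1 _]]]] := node_split nr (YX' _ zY).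
  by rewrite h3.
apply: (win_down (prefix_trans h2 p1)).
by apply: IH => //; apply: h5 => //; rewrite s1 h3.
Qed.

(** * Colours visible from a node *)

(** Here [g r] is meant to be the colour of a strong subtree above [r], which need not be [C r].
    Moving up the tree can only lose visible colours. *)
Definition sees b (g : seq bool -> 'I_k) c t :=
  has (fun r => [&& size r == b, prefix t r & g r == c]) T.

Lemma sees_down b g c t t' : prefix t t' -> sees b g c t' -> sees b g c t.
Proof.
move=> tt' /hasP[r rT /and3P[h1 h2 h3]]; apply/hasP; exists r => //.
by rewrite h1 h3 (prefix_trans tt' h2).
Qed.

Lemma sees_some b g t : b \in X -> node t -> size t <= b ->
  exists c, sees b g c t.
Proof.
move=> bX nt tb; have [r /andP[rT _] [rs rp]] := node_extend nt bX tb.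
by exists (g r); apply/hasP; exists r => //; rewrite rs rp !eqxx.
Qed.

(* Otherwise some successor misses a colour seen below it, which can happen at
   most [k] times on the way up. *)
Lemma common_color b g : b \in X -> forall n t (E : {set 'I_k}),
  node t -> #|~: E| <= n -> index (size t) X + n <= index b X ->
  (forall c, c \in E -> ~~ sees b g c t) ->
  exists s c, [/\ node s, prefix t s, size s < b &
    forall t', t' \in T -> size t' = next (size s) -> prefix s t' ->
      sees b g c t'].
Proof.
move=> bX; elim=> [|n IH] t E nt hE hn hsee.
all: have tX : size t \in X by case/andP: nt.
all: have tb : size t <= b by rewrite leqNgt -index_lt // -leqNgt; lia.
all: have [c hc] := sees_some g bX nt tb.
all: have cE : c \notin E by apply/negP=> /hsee; rewrite hc.
  (* [E] holds the colours already lost. With none left outside it, the visible colour [c] is a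
     contradiction. *)
  by move: hE; rewrite leqn0 cards_eq0 => /eqP/setP/(_ c); rewrite !inE cE.
have tb' : size t < b by rewrite -index_lt //; lia.
case: (boolP (has (fun t' => [&& size t' == next (size t), prefix t t' &
    ~~ sees b g c t']) T)) => [|/hasPn h]; last first.
  exists t, c; split=> // [|t' t'T st' pt']; first exact: prefix_refl.
  by have := h t' t'T; rewrite st' eqxx pt' /= negbK.
case/hasP=> t' t'T /and3P[/eqP st' pt' ns].
have ix : index (next (size t)) X = (index (size t) X).+1.
  rewrite index_uniq //; last exact: (sorted_uniq ltn_trans ltnn sX).
  by move: tb'; rewrite -index_lt // => h; apply: leq_ltn_trans h _; rewrite index_mem.
have [||||s [c' [h1 h2 h3 h4]]] := IH t' (c |: E).
- by rewrite /node t'T st' (next_mem tX bX).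
- rewrite -ltnS; apply: leq_trans hE; apply/proper_card/properP; split.
    by rewrite setCS subsetUr.
  by exists c; rewrite !inE ?eqxx.
- by rewrite st' ix; lia.
- move=> c' /setU1P[-> //|/hsee]; apply: contra; exact: sees_down.
by exists s, c'; split=> //; apply: prefix_trans h2.
Qed.

(** * Selecting blocks with constant colour above each root *)

Section Blocks.

Variables (N : nat) (e : nat -> nat) (L : nat -> seq nat)
  (f : nat -> seq bool -> 'I_k).
Hypotheses (eX : forall j, j < N -> e j \in X)
  (LX : forall j, j < N -> {subset L j <= X})
  (Le : forall j j' y, j < j' -> j' < N -> y \in L j -> y < e j')
  (e_mono : forall j j', j <= j' -> j' < N -> e j <= e j')
  (f_win : forall j r, j < N -> r \in T -> size r = e j ->
     win (f j r) (L j) top r).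

Lemma sees_win j c t : j < N -> sees (e j) (f j) c t -> win c (L j) top t.
Proof.
move=> jN /hasP[r rT /and3P[/eqP h1 h2 /eqP <-]].
exact: win_down h2 (f_win jN rT h1).
Qed.

Lemma color_dichotomy m z b (t : 'I_m -> seq bool) (w : 'I_m -> 'I_k) :
  (forall i r, node r -> prefix (t i) r -> size r <= b -> sees (e z) (f z) (w i) r) \/
  exists i r, [/\ node r, prefix (t i) r, size r <= b & ~~ sees (e z) (f z) (w i) r].
Proof.
case: (boolP [exists i, has (fun r => [&& size r \in X, prefix (t i) r,
    size r <= b & ~~ sees (e z) (f z) (w i) r]) T]).
  case/existsP=> i /hasP[r rT /and4P[h1 h2 h3 h4]]; right.
  by exists i, r; rewrite /node rT h1.
rewrite negb_exists => /forallP h; left=> i r /andP[rT rX] rp rb.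
apply/negPn/negP=> hs; have /hasP := h i; apply; exists r => //.
by rewrite rX rp rb.
Qed.

(** Each chosen block index carries a vector with one colour for each of the [m] roots. *)
Definition selection m := seq (nat * {ffun 'I_m -> 'I_k}).

Definition picked m (s : selection m) (v : {ffun 'I_m -> 'I_k}) :=
  flatten [seq L p.1 | p <- s & p.2 == v].

(** The blocks are required to fit together separately for each colour vector, since only blocks
    sharing a vector are joined in the end. *)
Definition good_selection m a b r (t : 'I_m -> seq bool) (s : selection m) :=
  [/\ size s = r, sorted ltn (map fst s),
    forall j, j \in map fst s -> a <= j < b &
    forall (v : {ffun 'I_m -> 'I_k}) i, win (v i) (picked s v) top (t i)].

(** The blocks already picked lie below level [e b], so every node reached through them sees [w i]
    at block [z] and can be continued by [L z]. Vectors other than [w] are unaffected. *)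
Lemma extend_selection m a b r z (t : 'I_m -> seq bool) s
    (w : {ffun 'I_m -> 'I_k}) : a <= b -> b <= z -> z < N ->
  (forall i, node (t i)) -> (forall i, size (t i) <= e a) ->
  (forall i r, node r -> prefix (t i) r -> size r <= e b -> sees (e z) (f z) (w i) r) ->
  good_selection a b r t s ->
  good_selection a z.+1 r.+1 t (rcons s (z, w)).
Proof.
move=> ab bz zN nt te hs [h1 h2 h3 h4].
have hp p : p \in s -> a <= p.1 < b by move=> /(map_f fst); apply: h3.
split.
- by rewrite size_rcons h1.
- rewrite map_rcons; case: (map fst s) h2 h3 => //= j0 J hJ0 hJ.
  rewrite rcons_path hJ0 /=; have /andP[_ hj] := hJ _ (mem_last j0 J).
  exact: leq_trans hj bz.
- by move=> j; rewrite map_rcons mem_rcons inE => /predU1P[->|/h3] /=; lia.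
move=> v i; rewrite /picked filter_rcons /=; case: eqP => [<-|_]; last exact: h4.
rewrite map_rcons flatten_rcons; apply: win_cat.
have hy y : y \in picked s w -> exists2 j, y \in L j & a <= j < b.
  case/flattenP=> ? /mapP[p]; rewrite mem_filter => /andP[_ ps] -> yL.
  by exists p.1; rewrite ?hp.
apply: (win_top (b := e b)) (h4 w i) => //.
- by apply: eX; lia.
- by move=> y /hy[j hj hab]; apply: (LX (j := j)) => //; lia.
- by move=> y /hy[j hj hab]; apply: (Le (j := j)) => //; lia.
- by apply: leq_trans (te i) _; apply: e_mono => //; lia.
- by move=> r' nr' pr' sr'; apply: sees_win => //; apply: hs nr' pr' sr'.
Qed.

(* Either all nodes reachable inside a segment of [l] blocks see the colour
   [w i] at the later block [z], which can then be appended to a selection made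
   in that segment, or some root moves up to a node that has lost one more
   colour at [z]. *)
Lemma append_block m l r z :
  (forall a (t : 'I_m -> seq bool), a + l <= N ->
     (forall i, node (t i)) -> (forall i, size (t i) <= e a) ->
     exists s, good_selection a (a + l) r t s) ->
  z < N ->
  forall n a (t : 'I_m -> seq bool) (E : 'I_m -> {set 'I_k}),
  a + n * l <= z -> \sum_i #|~: E i| < n ->
  (forall i c, c \in E i -> ~~ sees (e z) (f z) c (t i)) ->
  (forall i, node (t i)) -> (forall i, size (t i) <= e a) ->
  exists s, good_selection a z.+1 r.+1 t s.
Proof.
move=> IH zN; elim=> // n IHn a t E haz hE hsee nt te.
have hez : e a <= e z by apply: e_mono => //; lia.
have exc i : exists c, c \notin E i.
  have [c hc] := sees_some (f z) (eX zN) (nt i) (leq_trans (te i) hez).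
  by exists c; apply/negP=> /hsee; rewrite hc.
pose w := [ffun i => xchoose (exc i)].
have wE i : w i \notin E i by rewrite ffunE; apply: (xchooseP (exc i)).
have hal : a + l <= z by lia.
have [hs|[i [t' [nt' pt' st' hs']]]] := color_dichotomy z (e (a + l)) t w.
  have [|s hs0] := IH a t _ nt te; first by lia.
  by exists (rcons s (z, w)); apply: extend_selection hs0 => //; lia.
pose t2 j := if j == i then t' else t j.
pose E2 j := if j == i then w i |: E i else E j.
have pt2 j : prefix (t j) (t2 j).
  by rewrite /t2; case: eqP => [->|_] //; apply: prefix_refl.
have [|||||s [h1 h2 h3 h4]] := IHn (a + l) t2 E2; first by rewrite mulSn in haz; lia.
(* Root [i] alone changes, and the colour [w i] newly enters its set. *)
- rewrite ltnS in hE; apply: leq_trans hE; rewrite (bigD1 i) //= [X in _ < X](bigD1 i) //=.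
  rewrite [X in _ + X < _](eq_bigr (fun j => #|~: E j|)); last first.
    by move=> j /negPf hj; rewrite /E2 hj.
  rewrite ltn_add2r /E2 eqxx; apply/proper_card/properP; split.
    by rewrite setCS subsetUr.
  by exists (w i); rewrite !inE ?eqxx //=; apply: wE.
- move=> j c; rewrite /E2 /t2; case: eqP => [_|_]; last exact: hsee.
  case/setU1P=> [->|/hsee] //; apply: contra; exact: sees_down.
- by move=> j; rewrite /t2; case: eqP.
- move=> j; rewrite /t2; case: eqP => // _.
  by apply: leq_trans (te j) _; apply: e_mono; lia.
exists s; split=> //; first by move=> j /h3; lia.
by move=> v j; apply: win_down (pt2 j) (h4 v j).
Qed.

(** There are [m * k] pairs of a root and a colour to lose, so [(m * k).+1] segments of length [l]
    below block [z] suffice for [append_block]; the last factor [l] leaves room for [z] itself. *)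
Lemma selection_exists m r a (t : 'I_m -> seq bool) :
  a + (m * k).+2 ^ r <= N ->
  (forall i, node (t i)) -> (forall i, size (t i) <= e a) ->
  exists s, good_selection a (a + (m * k).+2 ^ r) r t s.
Proof.
elim: r a t => [|r IH] a t haN nt te; first by exists [::].
set l := (m * k).+2 ^ r in IH haN *.
have l0 : 0 < l by rewrite expn_gt0.
have e1 : (m * k).+2 ^ r.+1 = (m * k).+1 * l + l by rewrite expnS -/l; lia.
rewrite expnS -/l in haN.
have zN : a + (m * k).+1 * l < N by lia.
have hsum : \sum_(i < m) #|~: (set0 : {set 'I_k})| < (m * k).+1.
  by rewrite sum_nat_const setC0 cardsT !card_ord.
have [|s [h1 h2 h3 h4]] :=
  append_block IH zN (leqnn _) hsum (t := t) _ nt te.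
  by move=> i c; rewrite inE.
exists s; split=> //; move=> j /h3; rewrite e1; lia.
Qed.

Lemma constant_selection m n a (t : 'I_m -> seq bool) : 0 < k -> 0 < n ->
  a + (m * k).+2 ^ (n * k ^ m) <= N ->
  (forall i, node (t i)) -> (forall i, size (t i) <= e a) ->
  exists J (v : 'I_m -> 'I_k), [/\ n <= size J, sorted ltn J,
    forall j, j \in J -> a <= j < N &
    forall i, win (v i) (flatten [seq L j | j <- J]) top (t i)].
Proof.
move=> k0 n0 haN nt te; have [s [h1 h2 h3 h4]] := selection_exists haN nt te.
have [v hv] : exists v : {ffun 'I_m -> 'I_k}, n <= size [seq p <- s | p.2 == v].
  apply/existsP; apply: contraT; rewrite negb_exists => /forallP hlt.
  have : size s = \sum_v size [seq p <- s | p.2 == v].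
    elim: (s) => [|p s' IHs] /=; first by rewrite big1.
    rewrite (eq_bigr (fun v => (p.2 == v) + size [seq p <- s' | p.2 == v])).
      rewrite big_split /= -IHs (bigD1 p.2) //= eqxx big1 // => v /negPf hv.
      by rewrite eq_sym hv.
    by move=> v _; case: eqP.
  rewrite h1 => hsz; suff: n * k ^ m < n * k ^ m by rewrite ltnn.
  rewrite [X in X < _]hsz.
  (* Pigeonhole: otherwise each of the [k ^ m] vectors occurs at most [n.-1] times. *)
  apply: (leq_ltn_trans (n := \sum_(v : {ffun 'I_m -> 'I_k}) n.-1)).
    by apply: leq_sum => v _; rewrite -ltnS prednK // ltnNge; apply: hlt.
  rewrite sum_nat_const card_ffun !card_ord mulnC ltn_pmul2r; first by lia.
  by rewrite expn_gt0 k0.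
exists (map fst [seq p <- s | p.2 == v]), v; split.
- by rewrite size_map.
- apply: (subseq_sorted ltn_trans) h2; apply: map_subseq; exact: filter_subseq.
- move=> j /(mem_subseq (map_subseq _ (filter_subseq _ _))) /h3; lia.
- by move=> i; rewrite -map_comp; apply: h4.
Qed.

End Blocks.

(** * From strong subtrees to actual trees *)

(** The node [r] given by [win] becomes the only node on level [y]. Its two successors on the next
    level of [X] carry trees by induction, and these are glued. *)
Lemma win_tree (Ttree : is_tree T) c Z t : sorted ltn Z -> 0 < size Z ->
  {subset Z <= X} -> size t <= head 0 Z -> win c Z top t ->
  exists S, homogeneous_tree T C c t Z S.
Proof.
elim: Z t => // y Z IH t sZ _ ZX _ [r [rT tr ry Cr hr]].
have sZ' : sorted ltn Z by apply: path_sorted sZ.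
have ZX' : {subset Z <= X} by move=> x hx; apply: ZX; rewrite inE hx orbT.
have yX : y \in X by apply: ZX; rewrite inE eqxx.
have yZ z : z \in Z -> y < z.
  move=> hz; move: sZ; rewrite /= path_sortedE; last exact: ltn_trans.
  by case/andP=> /allP/(_ _ hz).
suff [S [[h1 h2 h3 h4 h5] h6]] : exists S, [/\ is_tree S, {subset S <= T},
    r \in S, comparable_to r S & quasistrong (y :: Z) S] /\
    (forall s, s \in S -> size s \in Z -> C s = c).
  have hu s : s \in S -> size s = y -> s = r.
    by move=> hs sy; apply: (comparable_size_eq h4) => //; rewrite sy.
  exists S; split=> //.
  - by move: tr; rewrite prefixE => /eqP <-; apply: h1.
  - exact: comparable_prefix tr h4.
  - split=> //; last by exists r.
    by move=> s hs; rewrite inE => /predU1P[/hu -> //|]; apply: h6.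
case Z0 : (size Z) => [|n].
  rewrite (size0nil Z0); have [S hS] := prefixes_tree Ttree rT ry.
  by exists S.
have hZ : head 0 Z \in Z by rewrite -nth0 mem_nth ?Z0.
have yh := yZ _ hZ; have hX := ZX' _ hZ.
have nr : node r by rewrite /node rT ry.
have [|t1 [t2 [t12 [n1 n2] [s1 s2] [p1 p2]]]] := node_split nr hX.
  by rewrite ry.
rewrite ry in s1 s2; have le := next_le yX hX yh; have gt := next_gt yX hX yh.
have /andP[t1T _] := n1; have /andP[t2T _] := n2.
have [|||S1 hS1] := IH t1 sZ' _ ZX'; rewrite ?Z0 ?s1 //; first exact: hr.
have [|||S2 hS2] := IH t2 sZ' _ ZX'; rewrite ?Z0 ?s2 //; first exact: hr.
exists (S1 ++ S2); apply: (join_trees (t1 := t1) (t2 := t2)); rewrite ?s1 ?s2 ?ry ?Z0 //.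
Qed.

(** * The induction on the exponent *)

(** One [Y] serves all roots, while the colour may depend on the root. Of the four sets, the first
    three provide the growth from one minimum to the next and the fourth provides the blocks. *)
Definition ramsey d := forall B, subseq B X ->
  (forall y, y \in B -> maxn 4 k < y) -> stack_large (large (2 * d)) 4 B ->
  exists Y, [/\ {subset Y <= B}, sorted ltn Y, relarge d (head 0 B) Y &
    forall r, r \in T -> size r = head 0 B ->
      exists c : 'I_k, win c Y top r].

Lemma ramsey0 : ramsey 0.
Proof.
move=> B BX _ [[|b B0] [B1 [-> // _ _ _]]]; exists [:: b]; split=> //=.
- by move=> y; rewrite !inE => /eqP ->; rewrite eqxx.
- by move=> u _; exists [::], b; rewrite /= eqxx.
- move=> r rT rs; exists (Ordinal (kC rT)); exists r; split=> //.
  exact: prefix_refl.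
Qed.

Lemma relarge_mem d b Y : relarge d b Y -> exists y, y \in Y.
Proof.
move=> /(_ 0 isT) [Z [w [h _]]]; exists w.
by apply: (mem_subseq h); rewrite mem_rcons inE eqxx.
Qed.

Lemma head_le B y : sorted ltn B -> y \in B -> head 0 B <= y.
Proof.
case: B => //= b B; rewrite path_sortedE; last exact: ltn_trans.
case/andP=> /allP h _; rewrite inE => /predU1P[->|/h] //; exact: ltnW.
Qed.

Lemma sorted_cat_lt (A B : seq nat) x y : sorted ltn (A ++ B) ->
  x \in A -> y \in B -> x < y.
Proof.
rewrite sorted_pairwise ?pairwise_cat; last exact: ltn_trans.
by case/andP=> /allrelP h _ xA yB; apply: h.
Qed.

Definition ramsey_block d (V : seq nat) b (L : seq nat) (g : seq bool -> 'I_k) :=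
  [/\ b \in V, {subset L <= V}, sorted ltn L, relarge d b L &
   (forall y, y \in L -> b <= y) /\
   forall r, r \in T -> size r = b -> win (g r) L top r].

Lemma ramsey_blocks (k0 : 0 < k) d n V : ramsey d -> subseq V X ->
  (forall y, y \in V -> maxn 4 k < y) ->
  stack_large (large (2 * d).+1) n V ->
  exists e L f, (forall j, j < n -> ramsey_block d V (e j) (L j) (f j)) /\
    forall j j' y, j < j' -> j' < n -> y \in L j -> y < e j'.
Proof.
move=> hr; elim: n V => [|n IH] V VX Vk /=.
  by move=> _; exists id, (fun=> [::]), (fun _ _ => Ordinal k0).
case=> V0 [V1 [eV V0n lV0 hV1]].
have sV : sorted ltn V by apply: (subseq_sorted ltn_trans VX sX).
have V0V : subseq V0 V by rewrite eV prefix_subseq.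
have V1V : subseq V1 V by rewrite eV suffix_subseq.
have [|y hy|e [L [f [h1 h2]]]] := IH V1 _ _ hV1; first exact: subseq_trans VX.
  by apply: Vk; apply: (mem_subseq V1V).
case: V0 V0n lV0 eV V0V => // x W _ lV0 eV V0V.
have xV : x \in V by rewrite eV inE eqxx.
(* The minimum [x] exceeds 4, so the stack above it has four sets to feed to [ramsey d]. *)
have [|B [B' [eW hB]]] := stack_large_take (m := 4) _ lV0.
  by have := Vk x xV; lia.
have BV : subseq B V.
  apply: subseq_trans V0V; apply: subseq_trans (subseq_cons _ _).
  by rewrite eW prefix_subseq.
have sB : sorted ltn B by apply: (subseq_sorted ltn_trans BV sV).
have [||Y [YB sY rY wY]] := hr B _ _ hB; first exact: subseq_trans VX.
  by move=> y /(mem_subseq BV); apply: Vk.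
have hBB : head 0 B \in B.
  by have [y /YB] := relarge_mem rY; case: (B) => //= b ? _; rewrite inE eqxx.
have [g hg] : exists g : seq bool -> 'I_k, forall r, r \in T ->
    size r = head 0 B -> win (g r) Y top r.
  apply: (finite_choice (P := fun r c => size r = head 0 B -> win (val c) Y top r) (Ordinal k0)) => r rT.
  case: (eqVneq (size r) (head 0 B)) => [/(wY r rT) [c hc]|/eqP hn].
    by exists c.
  (* A default colour for nodes off the level [head 0 B]. *)
  by exists (Ordinal k0).
exists (fun j => if j is j'.+1 then e j' else head 0 B).
exists (fun j => if j is j'.+1 then L j' else Y).
exists (fun j => if j is j'.+1 then f j' else g).
split; case=> [|j].
- move=> _; split=> //; first exact: (mem_subseq BV).
    by move=> y /YB /(mem_subseq BV).
  by split=> // y /YB; apply: head_le.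
- rewrite ltnS => /h1 [g1 g2 g3 g4 g5]; split=> //.
    exact: (mem_subseq V1V).
  by move=> y /g2 /(mem_subseq V1V).
- case=> // j' y _; rewrite ltnS => /h1 [g1 _ _ _ _] /YB yB.
  rewrite eV in sV; apply: (sorted_cat_lt sV) g1.
  by rewrite inE eW mem_cat yB orbT.
- by case=> // j' y; rewrite !ltnS; apply: h2.
Qed.

Lemma ramsey_step (k0 : 0 < k) d : ramsey d -> ramsey d.+1.
Proof.
move=> hr B BX Bk; rewrite mulnS add2n.
move=> [[|z Z1] [R1 [eB // _ l1]]] [[|z2 Z2] [R2 [eR1 // _ l2]]].
move=> [[|z3 Z3] [R3 [eR2 // _ l3]]] [[|z4 Z4] [R4 [eR3 // _ l4 _]]].
have sB : sorted ltn B by apply: (subseq_sorted ltn_trans BX sX).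
have zB : z \in B by rewrite eB mem_head.
have [zk zX] : maxn 4 k < z /\ z \in X by rewrite (mem_subseq BX) ?Bk.
have hB : head 0 B = z by rewrite eB.
have Z4B : subseq Z4 B.
  rewrite eB eR1 eR2 eR3; do 3 (apply: subseq_trans (suffix_subseq _ _)).
  exact: subseq_trans (subseq_cons _ _) (prefix_subseq _ _).
(* Each minimum exceeds the last element of the preceding set, which is exponentially large. *)
have [h2 h3 h4] : [/\ z * 2 ^ z <= z2, z2 * 2 ^ z2 <= z3 & z3 * 2 ^ z3 <= z4].
  move: sB; rewrite eB eR1 eR2 eR3 /= cat_path => /andP[p1 /= /andP[q1]].
  rewrite cat_path => /andP[p2 /= /andP[q2]]; rewrite cat_path => /andP[p3 /= /andP[q3 _]].
  have := large_last l1 p1; have := large_last l2 p2; have := large_last l3 p3.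
  by move=> *; split; apply: leq_trans (ltnW _); eauto.
have [|e [L [f [hblock hord]]]] := ramsey_blocks k0 hr (subseq_trans Z4B BX) _ l4.
  by move=> y /(mem_subseq Z4B); apply: Bk.
have Z4X y : y \in Z4 -> y \in X by move/(mem_subseq Z4B)/(mem_subseq BX).
have eX j : j < z4 -> e j \in X by case/hblock=> /Z4X.
have LX j : j < z4 -> {subset L j <= X} by case/hblock=> _ h _ _ _ y /h /Z4X.
have e_mono j j' : j <= j' -> j' < z4 -> e j <= e j'.
  rewrite leq_eqVlt => /predU1P[-> //|jj'] j'z.
  have [_ _ _ /relarge_mem[y yL] [le _]] := hblock j (ltn_trans jj' j'z).
  by apply: leq_trans (le _ yL) (ltnW _); apply: hord yL.
have f_win j r : j < z4 -> r \in T -> size r = e j -> win (f j r) (L j) top r.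
  by case/hblock=> _ _ _ _ [_]; apply.
pose l := undup [seq r <- T | size r == z].
have lP r : (r \in l) = (r \in T) && (size r == z).
  by rewrite mem_undup mem_filter andbC.
pose t (i : 'I_(size l)) := nth [::] l i.
have tl i : t i \in l by apply: mem_nth.
have nt i : node (t i).
  by have := tl i; rewrite lP /node => /andP[-> /eqP ->].
have z40 : 0 < z4.
  have : z4 \in B by rewrite eB eR1 eR2 eR3 !mem_cat mem_head !orbT.
  by move/Bk; lia.
have te i : size (t i) <= e 0.
  have := tl i; rewrite lP => /andP[_ /eqP ->].
  by have [/(mem_subseq Z4B) h _ _ _ _] := hblock 0 z40; rewrite -hB head_le.
(* [z.+1] blocks of equal vector are wanted: one for a starting element and up to [z] for the
   stack. *)
have bound : 0 + (size l * k).+2 ^ (z.+1 * k ^ size l) <= z4.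
  rewrite add0n; apply: block_count_bound h2 h3 h4; try lia.
  apply: size_uniq_strings; first exact: undup_uniq.
  by move=> s; rewrite lP => /andP[_ /eqP].
have [J [v [szJ sJ hJ wJ]]] :=
  constant_selection eX LX hord e_mono f_win k0 (ltn0Sn z) bound nt te.
have sub : {subset flatten [seq L j | j <- J] <= Z4}.
  move=> y /flattenP[? /mapP[j /hJ /= jz ->]].
  by have [_ h _ _ _] := hblock j jz; apply: h.
exists (flatten [seq L j | j <- J]); split.
- by move=> y /sub /(mem_subseq Z4B).
- apply: sorted_flatten => //; first by move=> j /hJ /= /hblock[].
  move=> j j' y y' _ /hJ /= j'z jj' yL y'L.
  have [_ _ _ _ [le _]] := hblock j' j'z.
  by apply: leq_trans (le _ y'L); apply: hord yL.
- rewrite hB; case: J szJ sJ hJ {wJ sub} => // j0 J szJ sJ hJ u uz.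
  have j0z : j0 < z4 by apply: (hJ j0); exact: mem_head.
  (* The first block only contributes [y], the minimum of the first set in the stack. *)
  have [_ _ _ /relarge_mem[y yL] _] := hblock j0 j0z.
  have J0 j : j \in J -> j0 < j.
    move: sJ; rewrite /= path_sortedE; last exact: ltn_trans.
    by case/andP=> /allP h _ /h.
  have inJ j : j \in J -> j < z4 by move=> jJ; apply: (hJ j); rewrite inE jJ orbT.
  have [|||||Z [w [lZ sZ]]] := relarge_chain (d := d) (e := e) (L := L) (J := J) (w := y) (n := u).
  + by move=> j /inJ /hblock[].
  + by move=> j j' x _ /inJ j'z jj' xL; apply: ltnW; apply: hord xL.
  + exact: path_sorted sJ.
  + by move=> j jJ; apply: ltnW; apply: (hord j0) yL; [exact: J0|exact: inJ].
  + by move: szJ; rewrite /=; lia.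
  exists Z, w; split=> //; apply: subseq_trans sZ _ => /=.
  by rewrite -cat1s; apply: cat_subseq => //; rewrite sub1seq.
- move=> r rT; rewrite hB => rz.
  have rl : r \in l by rewrite lP rT rz eqxx.
  have rlt : index r l < size l by rewrite index_mem.
  exists (v (Ordinal rlt)); have := wJ (Ordinal rlt).
  by rewrite /t /= nth_index.
Qed.

Lemma ramseyP (k0 : 0 < k) d : ramsey d.
Proof. by elim: d => [|d]; [exact: ramsey0|exact: ramsey_step]. Qed.

End Tree.

(** * Placing the lowest level below the homogeneous part *)

Theorem theorem2p3 (d k : nat) (X : seq nat) (T : seq (seq bool))
    (C : seq bool -> nat) :
  finset_nat X -> large (2 * d + 1) X -> maxn 4 k < head 0 X ->
  is_tree T -> quasistrong X T ->
  (forall s, s \in T -> C s < k) ->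
  exists (Y : seq nat) (S : seq (seq bool)),
    finset_nat Y /\ {subset Y <= X} /\ large d Y /\
    is_tree S /\ {subset S <= T} /\
    quasistrong Y S /\ prehomogeneous k C Y S.
Proof.
move=> sX; rewrite addn1; case: X sX => // x X' sX lX hx Ttree qT kC.
set X := x :: X' in sX qT *; rewrite /= in hx.
have xX : x \in X by apply: mem_head.
have [t0 t0T t0x] := qT.1 x xX.
have k0 : 0 < k by apply: leq_ltn_trans (kC _ t0T).
case: d lX => [_|d lX].
  (* A one-element [Y] has no gaps, so prehomogeneity is vacuous. *)
  exists [:: x], T; split=> //; split; first by move=> y; rewrite inE => /eqP ->.
  do 4 split=> //; last by exists 0.
  by split=> // y; rewrite inE => /eqP ->; exists t0.
(* The first set [X1] of the stack supplies [k] levels below [B]; the next four, available as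
   [x > 4], form [B]. *)
have [X1 [R1 [eX' X1n lX1 lR1]]] : exists X1 R1, [/\ X' = X1 ++ R1, X1 != [::],
    large (2 * d.+1) X1 & stack_large (large (2 * d.+1)) x.-1 R1].
  by move: lX; rewrite /= -[x in stack_large _ x](@prednK x) //; lia.
have [|B [R2 [eR1 lB]]] := stack_large_take (m := 4) _ lR1; first by lia.
have Xx y : y \in X -> x <= y.
  rewrite inE => /predU1P[-> //|yX']; move: sX; rewrite /finset_nat /= path_sortedE.
    by case/andP=> /allP h _; apply/ltnW/h.
  exact: ltn_trans.
have X1X : {subset X1 <= X} by move=> y hy; rewrite /X eX' inE mem_cat hy orbT.
have BX : subseq B X.
  rewrite /X eX' eR1; apply: subseq_trans (subseq_cons _ _).
  exact: subseq_trans (prefix_subseq _ _) (suffix_subseq _ _).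
have BX' := mem_subseq BX.
have [|Y [YB sY rY wY]] := ramseyP sX qT kC k0 BX _ lB.
  by move=> y /BX' /Xx; lia.
have [y0 y0Y] := relarge_mem rY.
set b := head 0 B in rY wY.
have bB : b \in B by move: (YB _ y0Y); rewrite /b; case: (B) => // *; apply: mem_head.
have bX := BX' _ bB.
have [g hg] : exists g : seq bool -> 'I_k, forall r, r \in T ->
    size r = b -> win X T C (g r) Y (fun=> True) r.
  apply: (finite_choice (P := fun r c => size r = b ->
    win X T C (val c) Y (fun=> True) r) (Ordinal k0)) => r rT.
  case: (eqVneq (size r) b) => [/(wY r rT) [c hc]|/eqP hn]; first by exists c.
  by exists (Ordinal k0).
have kb : k <= index b X.
  have sX1 : k <= size X1.
    case: X1 X1n lX1 X1X {eX'} => // y X1 _; rewrite mulnS add2n => lX1 X1X.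
    have := Xx y (X1X _ (mem_head _ _)); have := stack_large_size lX1.
    by move=> /=; lia.
  rewrite /X eX' eR1 -cat_cons index_cat; case: ifP => [hb|_] /=; last by lia.
  have sX2 : sorted ltn ((x :: X1) ++ (B ++ R2)) by rewrite cat_cons -eR1 -eX'.
  have bR : b \in B ++ R2 by rewrite mem_cat bB.
  by have := sorted_cat_lt sX2 hb bR; rewrite ltnn.
have nt0 : node X T t0 by rewrite /node t0T t0x.
have [|||s [c [ns _ sb hs]]] := common_color sX qT bX (g := g) (n := k) (E := set0) nt0.
- by rewrite setC0 cardsT card_ord.
- by rewrite t0x /= eqxx.
- by move=> c; rewrite inE.
have sX' : size s \in X by case/andP: ns.
have [t1 [t2 [t12 [n1 n2] [s1 s2] [p1 p2]]]] := node_split sX qT ns bX sb.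
(* [size s] is at most [b], hence admissible as the minimum to put in front of a part of [Y]. *)
have [Z [w [hZ lZ]]] := rY (size s) (ltnW sb).
have ZY : subseq Z Y := subseq_trans (subseq_rcons _ _) hZ.
have sZ : sorted ltn Z by apply: (subseq_sorted ltn_trans ZY).
have Z0 : 0 < size Z.
  have us : size s <= size Z := @stack_large_size (large d) _ _ lZ.
  apply: leq_trans us; apply: leq_trans (Xx _ sX').
  exact: leq_ltn_trans (leq0n _) hx.
have YX : {subset Y <= X} by move=> y /YB /BX'.
have ZX : {subset Z <= X} by move=> y /(mem_subseq ZY) /YX.
have bZ y : y \in Z -> b <= y.
  move=> /(mem_subseq ZY) /YB; apply: head_le.
  exact: (subseq_sorted ltn_trans BX sX).
have hZb : b <= head 0 Z by apply: bZ; rewrite -nth0 mem_nth.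
have gt := next_gt sX sX' bX sb; have le := next_le sX sX' bX sb.
have treeZ t : t \in T -> size t = next X (size s) -> prefix s t ->
    exists S, homogeneous_tree T C c t Z S.
  move=> tT ts st; have /hasP[r rT /and3P[/eqP rb tr /eqP gr]] := hs t tT ts st.
  apply: (win_tree sX qT Ttree sZ Z0 ZX); first by rewrite ts (leq_trans le hZb).
  apply: (win_subseq sX qT sY YX ZY); apply: win_down tr _.
  by rewrite -gr; apply: hg.
have /andP[t1T _] := n1; have /andP[t2T _] := n2.
have [S1 hS1] := treeZ t1 t1T s1 p1; have [S2 hS2] := treeZ t2 t2T s2 p2.
have [|||[h1 h2 h3 h4 h5] h6] :=
  join_trees p1 p2 t12 _ (erefl (size s)) _ _ Z0 sZ hS1 hS2.
- by rewrite s1 s2.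
- by rewrite s1.
- by rewrite s1 (leq_trans le hZb).
exists (size s :: Z), (S1 ++ S2); split.
  rewrite /finset_nat /= path_sortedE; last exact: ltn_trans.
  by rewrite sZ andbT; apply/allP=> y /bZ; apply: leq_trans.
split; first by move=> y; rewrite inE => /predU1P[->|/ZX].
do 4 split=> //.
exists (val c); first exact: ltn_ord.
(* The upper endpoint is the witness: its level lies in [Z], whereas the lowest node may have any
   colour. *)
move=> i hi r t rS rsz tS tsz rt _; exists t => //.
split=> //; first exact: prefix_refl.
by apply: h6 => //; rewrite tsz /= mem_nth.
Qed.
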